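(* Let $n\ge 1$, let $F$ be a field, let $S=F[x_1,\ldots,x_n,y_1,\ldots,y_n]$, and let $G$ be a finite, simple, undirected, connected graph on the vertex set $[n]=\{1,\ldots,n\}$. Let $\mathcal{J}_G=\langle x_iy_j-x_jy_i : \{i,j\}\in E(G)\rangle\subseteq S$ be the binomial edge ideal of $G$. Then the set $\mathcal{S}(\mathcal{J}_G)$ of binomials attached to weakly admissible paths in $G$, the universal Gröbner basis $\mathcal{U}(\mathcal{J}_G)$, and the Graver basis $\mathrm{Gr}(\mathcal{J}_G)$ coincide: $\mathcal{S}(\mathcal{J}_G)=\mathcal{U}(\mathcal{J}_G)=\mathrm{Gr}(\mathcal{J}_G)$.
   Context: $E(G)$ is the edge set of $G$. For $v,w\in[n]$, a $(v,w)$-path of length $r\ge 0$ in $G$ is a sequence of vertices $v=i_0,i_1,\ldots,i_r=w$ such that $\{i_k,i_{k+1}\}\in E(G)$ for all $k=0,\ldots,r-1$ (a priori vertices may repeat). Weakly admissible paths: an $(i,j)$-path $\pi=(i_0,\ldots,i_r)$ in $G$ is called weakly admissible if (i) $i_k\neq i_l$ whenever $k\neq l$; and (ii) for no proper subset $\{j_0,\ldots,j_s\}$ of $\{i_0,\ldots,i_r\}$ is $j_0,\ldots,j_s$ a path from $i$ to $j$ in $G$. For a weakly admissible $(i,j)$-path $\pi=(i_0,\ldots,i_r)$ put $\mathcal{S}_\pi:=\{t_{i_1}t_{i_2}\cdots t_{i_{r-1}}(x_iy_j-x_jy_i) : t_k\in\{x_k,y_k\}\}$, and let $\mathcal{S}(\mathcal{J}_G):=\bigcup_\pi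 \mathcal{S}_\pi\setminus\{0\}$, where $\pi$ runs over all weakly admissible paths in $G$ (for all $i,j\in[n]$; the only weakly admissible $(i,i)$-path is the path $(i)$ of length $0$, for which $\mathcal{S}_\pi=\{0\}$). A binomial means a nonzero difference $m-m'$ of two monic monomials of $S$. A binomial $m-m'$ in an ideal $I$ (generated by differences of monic monomials) is called primitive if there is no other binomial $p-p'\in I$ (i.e. $(p,p')\neq(m,m')$) such that $p$ divides $m$ and $p'$ divides $m'$. The Graver basis $\mathrm{Gr}(I)$ is the set of primitive binomials in $I$. The universal Gröbner basis $\mathcal{U}(I)$ is the union of all reduced Gröbner bases of $I$, over all monomial orders on $S$ (elements of a reduced Gröbner basis have leading coefficient $1$). *)

(* Defs.v *)
From mathcomp Require Import all_boot all_order all_algebra.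
From mathcomp Require Import classical_sets.
From mathcomp Require Import mpoly.

Set Implicit Arguments.
Unset Strict Implicit.
Unset Printing Implicit Defensive.

Import GRing.Theory.
Local Open Scope ring_scope.
Local Open Scope classical_set_scope.

Definition ideal_span (R : comNzRingType) (A : set R) : set R :=
  [set f | exists s : seq (R * R),
     (forall q, q \in s -> A q.2) /\ f = \sum_(q <- s) q.1 * q.2].

Section Groebner.
Variables (N : nat) (F : fieldType).
Implicit Types (le : rel 'X_{1..N}) (I A : set {mpoly F[N]}).
Implicit Types (f g : {mpoly F[N]}) (m p : 'X_{1..N}).

Definition monomial_order le : Prop :=
  [/\ total le, antisymmetric le, transitive le,
      (forall m, le 0%MM m)
    & (forall p m m', le m m' -> le (m + p)%MM (m' + p)%MM)].

(* Never holds for f = 0, whose support is empty. *)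
Definition lead_monomial le f m : Prop :=
  m \in msupp f /\ (forall m', m' \in msupp f -> le m' m).

Definition initial_ideal le A : set {mpoly F[N]} :=
  ideal_span [set t | exists f m,
    [/\ A f, lead_monomial le f m & t = 'X_[m]]].

Definition groebner_basis le I (G : seq {mpoly F[N]}) : Prop :=
  (forall g, g \in G -> I g) /\
  initial_ideal le [set` G] = initial_ideal le I.

(* [(m <= m')%MM] is the pointwise order on exponents, i.e. divisibility of
   monomials.  The first clause also excludes 0 from a reduced basis. *)
Definition reduced_groebner_basis le I (G : seq {mpoly F[N]}) : Prop :=
  [/\ groebner_basis le I G,
      (forall g, g \in G -> exists m, lead_monomial le g m /\ g@_m = 1)
    & (forall g h m m', g \in G -> h \in G -> g != h ->
         lead_monomial le g m -> m' \in msupp h -> ~~ (m <= m')%MM)].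

Definition universal_groebner_basis I : set {mpoly F[N]} :=
  [set f | exists le G,
    [/\ monomial_order le, reduced_groebner_basis le I G & f \in G]].

(* Primitivity is a property of the ordered pair (m, m') and not of the
   polynomial 'X_[m] - 'X_[m'], which in characteristic 2 does not determine
   the pair. *)
Definition binomial_in I m m' : Prop :=
  m != m' /\ I ('X_[m] - 'X_[m']).

Definition primitive_in I m m' : Prop :=
  binomial_in I m m' /\
  (forall p p', binomial_in I p p' -> (p <= m)%MM -> (p' <= m')%MM ->
     (p, p') = (m, m')).

Definition graver_basis I : set {mpoly F[N]} :=
  [set f | exists m m', primitive_in I m m' /\ f = 'X_[m] - 'X_[m']].

End Groebner.

Section BinomialEdgeIdeal.
Variables (n : nat) (F : fieldType) (e : rel 'I_n).

(* F[x_1..x_n, y_1..y_n]: the first n variables are the x_i, the last n the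
   y_i. *)
Local Notation S := {mpoly F[n + n]}.

Definition xvar (i : 'I_n) : S := 'X_(lshift n i).
Definition yvar (i : 'I_n) : S := 'X_(rshift n i).

Definition edge_binomial (i j : 'I_n) : S :=
  xvar i * yvar j - xvar j * yvar i.

Definition binomial_edge_ideal : set S :=
  ideal_span [set f | exists i j, e i j /\ f = edge_binomial i j].

(* The path i = i_0, i_1, ..., i_r = j is represented by i and the sequence
   [:: i_1; ...; i_r]; repeated vertices are allowed. *)
Definition graph_path (i j : 'I_n) (s : seq 'I_n) : Prop :=
  path e i s /\ last i s = j.

Definition weakly_admissible (i j : 'I_n) (s : seq 'I_n) : Prop :=
  [/\ graph_path i j s, uniq (i :: s)
    & ~ exists s' : seq 'I_n,
        graph_path i j s' /\ [set k in i :: s']%SET \proper [set k in i :: s]%SET].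

(* i_1, ..., i_(r-1); empty if r <= 1. *)
Definition interior (i : 'I_n) (s : seq 'I_n) : seq 'I_n :=
  behead (belast i s).

Definition path_binomials (i j : 'I_n) (s : seq 'I_n) : set S :=
  [set f | exists t : 'I_n -> S,
     (forall k, t k = xvar k \/ t k = yvar k) /\
     f = (\prod_(k <- interior i s) t k) * edge_binomial i j].

Definition weakly_admissible_binomials : set S :=
  [set f | (exists i j s, weakly_admissible i j s /\ path_binomials i j s f)
           /\ f <> 0].

End BinomialEdgeIdeal.

Arguments binomial_edge_ideal {n} F e _.
Arguments path_binomials {n} F i j s _.
Arguments weakly_admissible_binomials {n} F e _.

(* Main.v *)
Require Import Defs.
From mathcomp Require Import all_boot all_order all_algebra.
From mathcomp Require Import classical_sets boolp.
From mathcomp Require Import mpoly.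
From mathcomp Require Import ring zify.

(**
  Write I for the binomial edge ideal.  A monomial m puts, on each vertex k, as
  many x-tokens and y-tokens as the exponents of x_k and y_k; a generator of I
  swaps an x-token and a y-token of two adjacent vertices.  Hence a difference
  of monomials m - m' lies in I iff m' is reachable from m by swaps, and this
  has a combinatorial description (mem_binomial_key): m and m' have the same
  number of tokens on every vertex and, in every connected component of the
  subgraph induced by the vertices that carry a token, the same number of
  x-tokens.

  The binomial of a weakly admissible path from u to v says that an x-token on u
  and a y-token on v may be exchanged across one token on each interior vertex.
  The heart of the proof is key_split: if m and m' are distinct and in the same
  class, then a shortest path, inside the support, from a vertex with more
  x-tokens in m to one with fewer is weakly admissible; its interior vertices
  carry the same tokens in m as in m' by minimality, so they can be coloured in
  such a way that the two monomials of the path binomial divide m and m'.  Hence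
  primitive binomials are path binomials.  Conversely (path_primitive), a
  binomial below a path binomial is nontrivial only if its support joins u to v,
  and then weak admissibility forces it to be the whole path.

  For the universal Groebner basis one only uses that I is spanned by the
  differences within the classes.  Every monomial order picks a least monomial
  in each class; the monomials that are not least form the initial ideal, and
  the reduced basis consists of m minus the least monomial of the class of m,
  for m a minimal generator of the initial ideal.  All these binomials are
  primitive (reduced_primitive).  Conversely, a path binomial occurs in the
  reduced basis of an order that refines a weight vector under which the
  exchange of x_u y_v for x_v y_u is the only profitable one inside the path
  (path_universal).
*)

Set Implicit Arguments.
Unset Strict Implicit.
Unset Printing Implicit Defensive.

Import Order.TTheory GRing.Theory.
Local Open Scope ring_scope.
Local Open Scope classical_set_scope.

(** * Ideals spanned by a set *)

Section Ideals.
Variable R : comNzRingType.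
Implicit Types (A B : set R) (f g : R).

Lemma ideal_span0 A : ideal_span A 0.
Proof. by exists [::]; split=> //; rewrite big_nil. Qed.

Lemma ideal_spanD A f g :
  ideal_span A f -> ideal_span A g -> ideal_span A (f + g).
Proof.
move=> [s [As ->]] [t [At ->]]; exists (s ++ t); split; last by rewrite big_cat.
by move=> q; rewrite mem_cat => /orP[/As|/At].
Qed.

Lemma ideal_spanM A f g : ideal_span A g -> ideal_span A (f * g).
Proof.
move=> [s [As ->]]; exists [seq (f * q.1, q.2) | q <- s]; split.
  by move=> q /mapP[q' /As Aq' ->].
by rewrite big_map mulr_sumr; apply: eq_bigr => q _; rewrite mulrA.
Qed.

Lemma mem_ideal_span A f : A f -> ideal_span A f.
Proof.
move=> Af; exists [:: (1, f)]; split; last by rewrite big_seq1 mul1r.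
by move=> q; rewrite inE => /eqP->.
Qed.

Lemma ideal_span_sub A B : A `<=` ideal_span B -> ideal_span A `<=` ideal_span B.
Proof.
move=> AB _ [s [As ->]]; rewrite big_seq; elim/big_ind: _.
- exact: ideal_span0.
- by move=> f g; apply: ideal_spanD.
- by move=> q /As/AB; apply: ideal_spanM.
Qed.

End Ideals.

(** * Monomials and monomial orders *)

Section Monomials.
Variables (N : nat) (F : fieldType).
Implicit Types (m p q : 'X_{1..N}) (f : {mpoly F[N]}).

Lemma lepm_anti m m' : (m <= m')%MM -> (m' <= m)%MM -> m = m'.
Proof.
move=> /mnm_lepP mm' /mnm_lepP m'm; apply/mnmP => i.
by apply/eqP; rewrite eqn_leq mm' m'm.
Qed.

Lemma lepm_mdeg_eq m m' : (m <= m')%MM -> mdeg m = mdeg m' -> m = m'.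
Proof.
move=> mm' /eqP; rewrite -(submK mm') mdegD -{1}[mdeg m]add0n eqn_add2r eq_sym.
by rewrite mdeg_eq0 => /eqP->; rewrite add0m.
Qed.

Lemma monomial_ideal_dvd (A : set {mpoly F[N]}) (P : 'X_{1..N} -> Prop) m :
  (forall t, A t -> exists2 q, P q & t = 'X_[q]) ->
  ideal_span A 'X_[m] -> exists2 q, P q & (q <= m)%MM.
Proof.
move=> Amon [s [Ps Em]].
have: ('X_[F, m])@_m != 0 by rewrite mcoeffX eqxx oner_neq0.
rewrite Em raddf_sum /=; apply: contra_neqP => noq.
rewrite big_seq big1 // => -[a b] /= /Ps/Amon[q Pq /= ->].
apply: memN_msupp_eq0; apply/negP; rewrite (perm_mem (msuppMX _ _)).
by case/mapP => k _ Em'; apply: noq; exists q; rewrite // Em' lem_addr.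
Qed.

Lemma ideal_span_shift (A : set {mpoly F[N]}) q m m' :
  ideal_span A ('X_[m] - 'X_[m']) ->
  ideal_span A ('X_[q + m] - 'X_[q + m']).
Proof. by rewrite !mpolyXD -mulrBr; apply: ideal_spanM. Qed.

Lemma msupp_binomial m m' : m != m' ->
  msupp ('X_[m] - 'X_[m'] : {mpoly F[N]}) =i [:: m; m'].
Proof.
move=> ne k; rewrite mcoeff_msupp mcoeffB !mcoeffX !inE ![k == _]eq_sym.
case: (eqVneq m k) ne => [<-|_]; case: (eqVneq m' _) => // _ _;
  by rewrite ?subr0 ?sub0r ?oppr_eq0 ?oner_neq0 ?eqxx.
Qed.

Section Order.
Variable le : rel 'X_{1..N}.
Hypothesis le_mon : monomial_order le.

Lemma mon_le_refl : reflexive le.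
Proof. by case: le_mon => tot _ _ _ _ m; have:= tot m m; rewrite orbb. Qed.

Lemma mon_le_dvd m m' : (m <= m')%MM -> le m m'.
Proof.
case: le_mon => _ _ _ le0 leD mm'.
by rewrite -(submK mm') -{1}[m]add0m; apply/leD/le0.
Qed.

Lemma lead_monomial_uniq f m m' :
  lead_monomial le f m -> lead_monomial le f m' -> m = m'.
Proof.
case: le_mon => _ anti _ _ _ [fm mmax] [fm' mmax'].
by apply: anti; rewrite mmax' // mmax.
Qed.

Lemma lead_binomial m m' : m != m' -> le m' m ->
  lead_monomial le ('X_[m] - 'X_[m'] : {mpoly F[N]}) m.
Proof.
move=> ne mm'; split=> [|k]; rewrite msupp_binomial // !inE ?eqxx //.
by case/pred2P=> ->; rewrite ?mon_le_refl.
Qed.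

End Order.
End Monomials.

(** * Ideals spanned by differences within classes of monomials *)

Section ClassIdeal.
Variables (N : nat) (F : fieldType) (K : eqType) (key : 'X_{1..N} -> K).
Variables (A : set {mpoly F[N]}).
Local Notation I := (ideal_span A).
Implicit Types (m p q : 'X_{1..N}) (f : {mpoly F[N]}).
Hypothesis key_mdeg : forall m m', key m = key m' -> mdeg m = mdeg m'.
(* Compatibility of the classes with multiplication is asked of the generators
   only; it follows for all pairs of monomials in keyD. *)
Hypothesis A_key : forall f, A f ->
  exists m m', (forall q, key (q + m)%MM = key (q + m')%MM) /\ f = 'X_[m] - 'X_[m'].

(** The sum of the coefficients over a class is a linear form that kills each
    monomial multiple of a generator, hence kills the ideal. *)
Lemma class_sum f (kappa : K) : I f ->
  \sum_(m <- msupp f | key m == kappa) f@_m = 0.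
Proof.
move=> If; pose k := msize f.
pose phi (g : {mpoly F[N]}) : F := \sum_(m : 'X_{1..N < k} | key m == kappa) g@_m.
have phiX m : phi 'X_[m] = ((mdeg m < k)%N && (key m == kappa))%:R.
  rewrite /phi; case: (ltnP (mdeg m) k) => /= mk; last first.
    rewrite big1 // => j _; rewrite mcoeffX; case: eqP => // Em.
    by move: mk; rewrite Em leqNgt bmdeg.
  rewrite big_mkcond (bigD1 (BMultinom mk)) //= big1 ?addr0 => [|j].
    by rewrite mcoeffX eqxx; case: ifP.
  rewrite bmeqP /= mcoeffX eq_sym => /negPf->; by case: ifP.
have phiD g h : phi (g + h) = phi g + phi h.
  by rewrite /phi -big_split; apply: eq_bigr => j _; rewrite mcoeffD.
have phi0 : phi 0 = 0 by rewrite /phi big1 // => j _; rewrite mcoeff0.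
have phiZ c g : phi (c *: g) = c * phi g.
  by rewrite /phi mulr_sumr; apply: eq_bigr => j _; rewrite mcoeffZ.
have phiI : phi f = 0.
  have [s [As ->]] := If; rewrite big_seq; elim/big_ind: _ => //.
    by move=> g h g0 h0; rewrite phiD g0 h0 addr0.
  move=> [a b] /As /A_key[m [m' [mm' /= ->]]].
  rewrite (mpolyE a) mulr_suml; elim/big_ind: _ => //.
    by move=> g h g0 h0; rewrite phiD g0 h0 addr0.
  move=> i _; rewrite -scalerAl phiZ mulrBr -!mpolyXD.
  rewrite -[- _]scaleN1r phiD phiZ !phiX (key_mdeg (mm' i)) mm'.
  by rewrite mulN1r subrr mulr0.
rewrite -[RHS]phiI [in RHS](mpolyE f) (big_morph phi phiD phi0) big_mkcond.
rewrite big_seq [RHS]big_seq; apply: eq_bigr => m fm.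
by rewrite phiZ phiX msize_mdeg_lt //=; case: ifP; rewrite ?mulr1 ?mulr0.
Qed.

Lemma binomial_key m m' : I ('X_[m] - 'X_[m']) -> key m = key m'.
Proof.
case: (eqVneq m m') => [->//|ne] /(@class_sum _ (key m)).
rewrite (perm_big [:: m; m']) /=; last first.
  apply: uniq_perm; rewrite ?msupp_uniq //= ?inE ?ne //.
  exact: msupp_binomial.
rewrite !big_cons big_nil eqxx; case: eqP => [->//|_].
rewrite mcoeffB !mcoeffX eqxx eq_sym (negPf ne) subr0 addr0 => /eqP.
by rewrite oner_eq0.
Qed.

Hypothesis I_key : forall m m', key m = key m' -> I ('X_[m] - 'X_[m']).

Lemma keyD q m m' : key m = key m' -> key (q + m)%MM = key (q + m')%MM.
Proof.
by move=> /I_key/(ideal_span_shift q)/binomial_key.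
Qed.

(** Otherwise the sum of the coefficients over the class of m would be the
    coefficient of m. *)
Lemma class_mate f m : I f -> m \in msupp f ->
  exists m', [/\ m' \in msupp f, m' != m & key m' = key m].
Proof.
move=> If fm; have := @class_sum _ (key m) If.
case: (boolP (has (fun m' => (key m' == key m) && (m' != m)) (msupp f))).
  by move=> /hasP[m' fm' /andP[/eqP km' ne]] _; exists m'.
move=> /hasPn none; rewrite big_mkcond (bigD1_seq m) ?msupp_uniq //= eqxx.
rewrite big_seq_cond big1 ?addr0 => [/eqP|j /andP[fj nej]].
  by rewrite mcoeff_eq0 fm.
by have := none j fj; rewrite nej andbT => /negPf->.
Qed.

Section Minimum.
Variable le : rel 'X_{1..N}.
Hypothesis le_mon : monomial_order le.

(** Classes are finite since they are homogeneous, so that the least element for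
    an arbitrary monomial order can be searched among bounded multidegrees. *)
Definition class_min m : 'X_{1..N} :=
  extremum le (BMultinom (ltnSn (mdeg m))) (fun w => key w == key m) val.

Lemma class_minP m :
  key (class_min m) = key m /\ forall w, key w = key m -> le (class_min m) w.
Proof.
case: (le_mon) => tot _ tr _ _; rewrite /class_min.
case: extremumP => //= [|w /eqP kw wmin]; first exact: mon_le_refl.
split=> // v kv.
have dv : (mdeg v < (mdeg m).+1)%N by rewrite (key_mdeg kv).
by apply: (wmin (BMultinom dv)); apply/eqP.
Qed.

Lemma key_class_min m : key (class_min m) = key m.
Proof. by case: (class_minP m). Qed.

Lemma class_min_le m m' : key m' = key m -> le (class_min m) m'.
Proof. by case: (class_minP m) => _; apply. Qed.

Lemma class_min_key m m' : key m = key m' -> class_min m = class_min m'.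
Proof.
case: (le_mon) => _ anti _ _ _ km; apply: anti.
by rewrite !class_min_le // key_class_min.
Qed.

Lemma class_min_id m : class_min (class_min m) = class_min m.
Proof. exact/class_min_key/key_class_min. Qed.

(** The monomials that are not least in their class form an ideal: multiplying a
    strict decrease inside a class gives a strict decrease. *)
Lemma class_min_dvd m m' :
  class_min m' = m' -> (m <= m')%MM -> class_min m = m.
Proof.
case: (le_mon) => _ anti _ _ leD m'min mm'.
apply: (@addmI _ (m' - m)%MM); apply: anti; apply/andP; split.
  by rewrite ![(m' - m + _)%MM]addmC; apply/leD/class_min_le.
by rewrite {1}submK // -{1}m'min; apply: class_min_le; rewrite -{2}(submK mm');
   apply/keyD/key_class_min.
Qed.

Lemma lead_not_class_min f m : I f -> lead_monomial le f m -> class_min m <> m.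
Proof.
case: (le_mon) => _ anti _ _ _ If [fm mmax] minm.
have [m' [fm' /eqP ne km']] := class_mate If fm; apply: ne.
by apply: anti; rewrite mmax //= -[m in le m]minm class_min_le.
Qed.

(** The minimal monomial generators of the initial ideal, which is spanned by the
    monomials that are not least in their class. *)
Definition minimal_initial m : Prop :=
  class_min m <> m /\
  forall q, (q <= m)%MM -> class_min q <> q -> q = m.

Lemma minimal_initial_exists m : class_min m <> m ->
  exists2 q, minimal_initial q & (q <= m)%MM.
Proof.
have [d] := ubnP (mdeg m); elim: d m => // d IHd m; rewrite ltnS => dm nonm.
have [minm|/not_andP[//|/existsNP[q /not_implyP[qm /not_implyP[nonq neq]]]]] :=
  pselect (minimal_initial m); first by exists m; rewrite ?lepm_refl.
have [|//|r minr rq] := IHd q; last by exists r; rewrite // (lepm_trans rq).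
apply: leq_trans dm; rewrite ltn_neqAle; apply/andP; split.
  by apply/eqP => /(lepm_mdeg_eq qm).
by rewrite -(submK qm) mdegD leq_addl.
Qed.

(** If p divides m and p' divides the least monomial of the class of m, then p' is
    least in its class; so p is in the initial ideal unless p = p', which forces
    p = m by minimality of m, and p' is then found by comparing degrees. *)
Lemma minimal_initial_primitive m :
  minimal_initial m -> primitive_in I m (class_min m).
Proof.
move=> [nonm mmin]; split.
  split; first by apply/eqP => /esym.
  by apply/I_key/esym/key_class_min.
move=> p p' [pp' /binomial_key kp] pm pm'.
have [minp|nonp] := pselect (class_min p = p).
  case/eqP: pp'; rewrite -minp (class_min_key kp).
  exact: class_min_dvd (class_min_id m) pm'.
rewrite (mmin p pm nonp) in kp *; congr pair.
by apply: lepm_mdeg_eq pm' _; apply: key_mdeg; rewrite -kp key_class_min.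
Qed.

(** An element f of a reduced basis has a single monomial in the initial ideal, its
    leading monomial m; the others are least in their class.  As no monomial
    of f is alone in its class, f involves no class but that of m, whose only
    other monomial in f is the least one; so f is m minus that monomial. *)
Lemma reduced_primitive G f :
  reduced_groebner_basis le I G -> f \in G -> graver_basis I f.
Proof.
case: (le_mon) => _ anti _ _ _ [[GI inG] Glead Gred] Gf.
have [m [[fm mmax] fm1]] := Glead f Gf; have If := GI f Gf.
have lead_dvd k : class_min k <> k ->
    exists h q, [/\ h \in G, lead_monomial le h q & (q <= k)%MM].
  move=> nonk; have: initial_ideal le I ('X_[k]).
    apply: mem_ideal_span; exists ('X_[k] - 'X_[class_min k]), k; split=> //.
      by apply/I_key/esym/key_class_min.
    by apply: lead_binomial => //; [apply/eqP => /esym | apply: class_min_le].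
  rewrite -inG => /(@monomial_ideal_dvd _ _ _
    (fun q => exists2 h, h \in G & lead_monomial le h q))[|q [h Gh hq] qk].
    by move=> t [h [q [Gh hq ->]]]; exists q => //; exists h.
  by exists h, q.
have tail_min k : k \in msupp f -> k <> m -> class_min k = k.
  move=> fk km; apply: contrapT => /lead_dvd[h [q [Gh hq qk]]].
  have [Eh|nehf] := eqVneq h f; last by have /negP := Gred h f q k Gh Gf nehf hq fk.
  apply: km; apply: anti; rewrite mmax //=; apply: (mon_le_dvd le_mon).
  by rewrite (lead_monomial_uniq le_mon (conj fm mmax) (m' := q)) // -Eh.
have minm : minimal_initial m.
  split; first exact: lead_not_class_min If (conj fm mmax).
  move=> p pm /lead_dvd[h [q [Gh hq qp]]].
  have [Eh|nehf] := eqVneq h f; last first.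
    by have /negP[] := Gred h f q m Gh Gf nehf hq fm; apply: lepm_trans pm.
  apply: lepm_anti pm _.
  by rewrite (lead_monomial_uniq le_mon (conj fm mmax) (m' := q)) // -Eh.
(* The mate of k in f is m, as two distinct least monomials have distinct classes. *)
have tail k : k \in msupp f -> k <> m -> k = class_min m.
  move=> fk km; have [k' [fk' ne kk']] := class_mate If fk.
  have [Ek'|/eqP k'm] := eqVneq k' m.
    by rewrite -(tail_min k) //; apply: class_min_key; rewrite -kk' Ek'.
  by case/eqP: ne; rewrite -(tail_min k) // -(tail_min k') //; apply: class_min_key.
exists m, (class_min m); split; first exact: minimal_initial_primitive.
(* f - b is supported on a single monomial, which has no mate there. *)
set b := 'X_[m] - _; apply/eqP; rewrite -subr_eq0 -msupp_eq0.
have Ib : I (f - b).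
  apply: ideal_spanD => //; rewrite -mulN1r; apply: ideal_spanM.
  by apply/I_key/esym/key_class_min.
have suppb k : k \in msupp (f - b) -> k = class_min m.
  apply: contraPP => kc; apply/negP; rewrite -mcoeff_eq0 !mcoeffB !mcoeffX.
  rewrite [class_min m == k]eq_sym (introF eqP kc) subr0.
  have [<-|mk] := eqVneq m k; first by rewrite fm1 subrr.
  rewrite subr0 mcoeff_eq0; apply/negP => fk; apply: kc; apply: tail => //.
  by apply/eqP; rewrite eq_sym.
case E: (msupp (f - b)) => [//|k s].
have bk : k \in msupp (f - b) by rewrite E mem_head.
have [k' [bk' /eqP ne _]] := class_mate Ib bk.
by case: ne; rewrite (suppb k) // (suppb k').
Qed.

(** The two divisibility conditions say that m is a minimal generator of the
    initial ideal and that m' is least in its class.  It is enough to test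
    primitive binomials because each monomial of the initial ideal is a multiple
    of the leading monomial of one.  The bound d makes the reduced basis, which
    is built explicitly, a finite list. *)
Lemma primitive_universal d m m' :
    (forall p p', primitive_in I p p' -> (mdeg p < d)%N) ->
    primitive_in I m m' ->
    (forall p p', primitive_in I p p' -> (p <= m)%MM -> le p' p -> p = m) ->
    (forall p p', primitive_in I p p' -> (p <= m')%MM -> ~~ le p' p) ->
  universal_groebner_basis I ('X_[m] - 'X_[m']).
Proof.
move=> Pd Pmm' Pm Pm'; have [[/eqP mm' /binomial_key km] _] := Pmm'.
have min_prim p : minimal_initial p ->
    primitive_in I p (class_min p) /\ le (class_min p) p.
  by move=> minp; split; [apply: minimal_initial_primitive | apply: class_min_le].
have minm' : class_min m' = m'.
  apply: contrapT => /minimal_initial_exists[p /min_prim[Pp lep] pm'].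
  by have := Pm' _ _ Pp pm'; rewrite lep.
have cm : class_min m = m' by rewrite (class_min_key km).
have minm : minimal_initial m.
  split=> [|q qm /minimal_initial_exists[p /min_prim[Pp lep] pq]].
    by rewrite cm => /esym.
  by apply: (lepm_anti qm); rewrite -(Pm _ _ Pp (lepm_trans pq qm) lep).
pose red (p : 'X_{1..N}) : {mpoly F[N]} := 'X_[p] - 'X_[class_min p].
pose G := [seq red (val p) | p : 'X_{1..N < d} <- enum predT & `[< minimal_initial (val p) >]].
have GP g : reflect (exists2 p, minimal_initial p & g = red p) (g \in G).
  apply: (iffP mapP) => [[p] | [p minp ->]].
    by rewrite mem_filter => /andP[/asboolP minp _] ->; exists (val p).
  have pd : (mdeg p < d)%N by apply: Pd (minimal_initial_primitive minp).
  exists (BMultinom pd) => //; rewrite mem_filter mem_enum andbT.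
  exact/asboolP.
have red_lead p : minimal_initial p -> lead_monomial le (red p) p.
  move=> [nonp _]; apply: lead_binomial => //; first by apply/eqP => /esym.
  exact: class_min_le.
exists le, G; split=> //; last by apply/GP; exists m => //; rewrite /red cm.
have GI g : g \in G -> I g.
  by move=> /GP[p _ ->]; apply/I_key/esym/key_class_min.
split; first split=> //.
- rewrite /initial_ideal; apply/seteqP; split; apply: ideal_span_sub => _ [g [p [Ag gp ->]]].
    by apply: mem_ideal_span; exists g, p; split=> //; apply: GI.
  have [q minq qp] := minimal_initial_exists (lead_not_class_min Ag gp).
  rewrite -(submK qp) mpolyXD; apply/ideal_spanM/mem_ideal_span.
  by exists (red q), q; split; rewrite //=; [apply/GP; exists q | apply: red_lead].
- move=> _ /GP[p minp ->]; exists p; split; first exact: red_lead.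
  have [/eqP nonp _] := minp.
  by rewrite mcoeffB !mcoeffX eqxx (negPf nonp) subr0.
move=> _ _ q k /GP[p minp ->] /GP[p' minp' ->] ne.
move=> /(lead_monomial_uniq le_mon (red_lead p minp)) <-.
have [nonp _] := minp; have [/eqP nonp' minp'2] := minp'.
rewrite msupp_binomial; last by rewrite eq_sym.
rewrite !inE => /pred2P[]->; apply/negP => pp'.
  by case/eqP: ne; rewrite (minp'2 p).
by apply: nonp; apply: class_min_dvd (class_min_id p') pp'.
Qed.

End Minimum.
End ClassIdeal.

(** * Token configurations on a graph *)

Section Tokens.
Variables (n : nat) (e : rel 'I_n).
Hypothesis e_sym : ssrbool.symmetric e.
Implicit Types (m : 'X_{1..n + n}) (i j k u v w : 'I_n) (s : seq 'I_n).

Definition vertex_deg m k : nat := (m (lshift n k) + m (rshift n k))%N.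

(** The subgraph through which swaps can move tokens of m: a vertex without a
    token blocks the way. *)
Definition live m : rel 'I_n :=
  [rel i j | [&& e i j, (0 < vertex_deg m i)%N & (0 < vertex_deg m j)%N]].

Lemma liveE m i j : live m i j = [&& e i j, 0 < vertex_deg m i & 0 < vertex_deg m j]%N.
Proof. by []. Qed.

Definition component_xdeg m i : nat := (\sum_(k | connect (live m) i k) m (lshift n k))%N.

(** A complete invariant of monomials modulo the binomial edge ideal; see
    mem_binomial_key. *)
Definition component_key m : {ffun 'I_n -> nat * nat} :=
  [ffun i => (vertex_deg m i, component_xdeg m i)].

Lemma key_vertex_deg m m' : component_key m = component_key m' -> vertex_deg m =1 vertex_deg m'.
Proof. by move=> /ffunP E i; have := E i; rewrite !ffunE => -[]. Qed.

Lemma key_component_xdeg m m' :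
  component_key m = component_key m' -> component_xdeg m =1 component_xdeg m'.
Proof. by move=> /ffunP E i; have := E i; rewrite !ffunE => -[]. Qed.

Lemma key_mdeg m m' : component_key m = component_key m' -> mdeg m = mdeg m'.
Proof.
move=> /key_vertex_deg E; rewrite !mdegE !big_split_ord /= -!big_split.
by apply: eq_bigr => i _; apply: E.
Qed.

Lemma live_eq m m' : vertex_deg m =1 vertex_deg m' -> live m =2 live m'.
Proof. by move=> E i j; rewrite !liveE !E. Qed.

Lemma live_connect_sym m : connect_sym (live m).
Proof.
apply: sym_connect_sym => i j; rewrite !liveE e_sym.
by case: (0 < vertex_deg m i)%N; case: (0 < vertex_deg m j)%N.
Qed.

Lemma live_path m u s : path (live m) u s -> path e u s.
Proof. by apply: sub_path => i j /and3P[]. Qed.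

Lemma path_live m u s :
  path e u s -> (forall k, k \in u :: s -> (0 < vertex_deg m k)%N) -> path (live m) u s.
Proof.
elim: s u => //= w s IHs u /andP[uw ws] pos.
rewrite liveE uw !pos ?inE ?eqxx ?orbT //=; apply: IHs => // k ks.
by apply: pos; rewrite inE ks orbT.
Qed.

Lemma live_pos m u s : s != [::] -> path (live m) u s ->
  forall k, k \in u :: s -> (0 < vertex_deg m k)%N.
Proof.
elim: s u => //= w s IHs u _ /andP[/and3P[_ u0 w0] ws] k.
rewrite inE => /predU1P[->//|]; case: s => [|w' s] in IHs ws *.
  by rewrite inE => /eqP->.
exact: IHs.
Qed.

(** Both ends of the edge carry a token before and after the swap, so they stay in
    one component, whose count of x-tokens is unchanged. *)
Lemma edge_swap_key i j (q : 'X_{1..n + n}) : e i j ->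
  component_key (q + (U_(lshift n i) + U_(rshift n j)))%MM =
  component_key (q + (U_(lshift n j) + U_(rshift n i)))%MM.
Proof.
set m := (q + _)%MM; set m' := (q + (U_(lshift n j) + _))%MM => eij.
have mE t : m t = (q t + ((lshift n i == t) + (rshift n j == t)))%N.
  by rewrite !mnmDE !mnm1E.
have m'E t : m' t = (q t + ((lshift n j == t) + (rshift n i == t)))%N.
  by rewrite !mnmDE !mnm1E.
have vE : vertex_deg m =1 vertex_deg m'.
  move=> k; rewrite /vertex_deg !mE !m'E !eq_lshift !eq_rshift !eq_lrshift !eq_rlshift.
  lia.
have ij : live m i j.
  rewrite !liveE eij /vertex_deg !mE !eq_lshift !eq_rshift !eqxx; lia.
have cij k : connect (live m) k i = connect (live m) k j.
  by apply: (same_connect_r (@live_connect_sym m)); apply: connect1.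
apply/ffunP => k; rewrite !ffunE vE; congr pair; rewrite /component_xdeg.
under [RHS]eq_bigl => w do rewrite -(eq_connect (live_eq vE)).
under eq_bigr => w _ do rewrite mE eq_lshift eq_rlshift addn0.
under [RHS]eq_bigr => w _ do rewrite m'E eq_lshift eq_rlshift addn0.
rewrite !big_split /=; congr addn.
have sumE a : (\sum_(w | connect (live m) k w) (a == w) = connect (live m) k a)%N.
  rewrite big_mkcond (bigD1 a) //= eqxx big1 => [|w /negPf wa].
    by case: ifP.
  by rewrite eq_sym wa; case: ifP.
by rewrite !sumE cij.
Qed.

(** One monomial of the binomial of the path u, s, v: an x-token on u, a y-token
    on v and, on each interior vertex k, an x-token if c k and a y-token
    otherwise.  The other monomial is obtained by exchanging u and v. *)
Definition path_mon u v s (c : pred 'I_n) : 'X_{1..n + n} :=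
  ((\sum_(k <- s) U_(if c k then lshift n k else rshift n k))
   + (U_(lshift n u) + U_(rshift n v)))%MM.

Lemma sum_nat_mem_uniq s (P : pred 'I_n) k : uniq s ->
  (\sum_(w <- s) (P w && (w == k)) = (k \in s) && P k)%N.
Proof.
elim: s => [|w s IHs] /=; first by rewrite big_nil.
move=> /andP[ws us]; rewrite big_cons IHs // inE [k == w]eq_sym.
case: eqVneq => [<-|_]; last by rewrite andbF.
by rewrite (negPf ws) andbT addn0.
Qed.

Lemma path_monL u v s c k : uniq s ->
  path_mon u v s c (lshift n k) = ((k \in s) && c k + (u == k))%N.
Proof.
move=> us; rewrite !mnmDE !mnm1E eq_lshift eq_rlshift addn0 mnm_sumE.
rewrite -(sum_nat_mem_uniq c k us); congr addn; apply: eq_bigr => w _.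
by rewrite mnm1E; case: (c w); rewrite ?eq_lshift ?eq_rlshift.
Qed.

Lemma path_monR u v s c k : uniq s ->
  path_mon u v s c (rshift n k) = ((k \in s) && ~~ c k + (v == k))%N.
Proof.
move=> us; rewrite !mnmDE !mnm1E eq_rshift eq_lrshift add0n mnm_sumE.
rewrite -(sum_nat_mem_uniq (predC c) k us); congr addn; apply: eq_bigr => w _.
by rewrite mnm1E /=; case: (c w); rewrite ?eq_rshift ?eq_lrshift.
Qed.

(** Weak admissibility with the last vertex singled out, s being the interior. *)
Definition chordless u v s : Prop :=
  [/\ path e u (rcons s v), uniq (u :: rcons s v)
    & forall s', path e u s' -> last u s' = v ->
        {subset u :: s' <= u :: rcons s v} -> {subset u :: rcons s v <= u :: s'}].

Lemma chordlessP u v s : chordless u v s <-> weakly_admissible e u v (rcons s v).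
Proof.
split=> [[us su smin]|[[us _] su smin]]; split=> //.
- by split; rewrite ?last_rcons.
- move=> [s' [[us' sv'] /fintype.properP[/fintype.subsetP sub [w]]]].
  rewrite !inE => ws; rewrite -in_cons in ws; case/negP.
  rewrite -in_cons; apply: smin => // k ks.
  by have := sub k; rewrite !inE -!in_cons; apply.
move=> s' us' sv' sub k ks; apply: contrapT => /negP nk; apply: smin; exists s'.
split=> //; apply/fintype.properP; split; last by exists k; rewrite !inE -?in_cons.
by apply/fintype.subsetP => w; rewrite !inE -!in_cons; apply: sub.
Qed.

(** Among the paths, in the support, from a vertex with a surplus of x-tokens in m
    (relative to m') to a vertex with a deficit, take a shortest one.  A path
    on fewer of its vertices would be shorter, so it is weakly admissible.  An
    interior vertex with a surplus or a deficit could replace one of the ends, so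
    m and m' agree on the interior.  The two strict inequalities ensure that the
    exchange brings m closer to m'. *)
Lemma key_split m m' : component_key m = component_key m' -> m <> m' ->
  exists u v s c, [/\ chordless u v s,
    (path_mon u v s c <= m)%MM /\ (path_mon v u s c <= m')%MM,
    (m' (lshift n u) < m (lshift n u))%N &
    (m (lshift n v) < m' (lshift n v))%N].
Proof.
move=> km nemm'; have vE := key_vertex_deg km; have xE := key_component_xdeg km.
have vD k : (m (lshift n k) + m (rshift n k) = m' (lshift n k) + m' (rshift n k))%N.
  exact: vE.
pose sur k := (m' (lshift n k) < m (lshift n k))%N.
pose def k := (m (lshift n k) < m' (lshift n k))%N.
pose good L := [exists u, exists v, exists s : L.-tuple 'I_n,
  [&& sur u, def v, path (live m) u s & last u s == v]].
have goodI u v s : sur u -> def v -> path (live m) u s -> last u s = v ->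
    good (size s).
  move=> su dv us sv; apply/existsP; exists u; apply/existsP; exists v.
  by apply/existsP; exists (in_tuple s); rewrite su dv us sv /= eqxx.
have ex_good : exists L, good L.
  have [k nek] : exists k, m (lshift n k) != m' (lshift n k).
    apply/existsP; apply: contra_notT nemm'; rewrite negb_exists => /forallP E.
    apply/mnmP => t; rewrite -(splitK t); case: (split t) => k /=;
      have /eqP Ek := negbNE (E k); first by [].
    by have := vD k; rewrite Ek => /addnI.
  (* m and m' differ at k; as the component of k has as many x-tokens in both,
     a surplus is compensated there by a deficit, and vice versa. *)
  have [u [v [su dv uv]]] :
      exists u v, [/\ sur u, def v & connect (live m) u v].
    have := xE k; rewrite /component_xdeg.
    under [RHS]eq_bigl => w do rewrite -(eq_connect (live_eq vE)).
    move=> sE; case: (ltngtP (m (lshift n k)) (m' (lshift n k))) nek => // kk _.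
    - suff /existsP[u /andP[ku su]] : [exists u, connect (live m) k u && sur u].
        by exists u, k; rewrite live_connect_sym.
      apply: contraPT sE; rewrite negb_exists => /forallP none; apply/eqP.
      rewrite ltn_eqF // (bigD1 k) ?connect0 //= [ltnRHS](bigD1 k) ?connect0 //=.
      rewrite -addSn leq_add //; apply: leq_sum => w /andP[kw _].
      by have := none w; rewrite kw /= -leqNgt.
    - suff /existsP[v /andP[kv dv]] : [exists v, connect (live m) k v && def v].
        by exists k, v.
      apply: contraPT sE; rewrite negb_exists => /forallP none; apply/eqP.
      rewrite gtn_eqF // (bigD1 k) ?connect0 //= [ltnRHS](bigD1 k) ?connect0 //=.
      rewrite -addSn leq_add //; apply: leq_sum => w /andP[kw _].
      by have := none w; rewrite kw /= -leqNgt.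
  have /connectP[s us vs] := uv; exists (size s).
  exact: goodI su dv us (esym vs).
case: (ex_minnP ex_good) => L /existsP[u /existsP[v /existsP[s0]]].
move=> /and4P[su dv + +] Lmin; case/shortenP => s us0 uniqs ss0 /eqP sv.
have {ss0} sL : (size s <= L)%N.
  rewrite -(size_tuple s0); apply: uniq_leq_size => //.
  by case/andP: uniqs.
have min_len a b t : sur a -> def b -> path (live m) a t -> last a t = b ->
    (size s <= size t)%N.
  by move=> sa db at' tb; apply/(leq_trans sL)/Lmin/goodI/tb.
case/lastP: s => [|s v'] in us0 uniqs sv sL min_len *.
  by move: su dv; rewrite -sv /sur /def /=; lia.
rewrite last_rcons in sv; rewrite {v'}sv in us0 uniqs sL min_len *.
have pos : forall k, k \in u :: rcons s v -> (0 < vertex_deg m k)%N.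
  by apply: live_pos us0; case: (s).
have us := live_path us0.
(* An interior vertex with a surplus starts, and one with a deficit ends, a
   shorter path. *)
have bal w : w \in s -> m (lshift n w) = m' (lshift n w).
  move=> ws; suff: ~~ sur w /\ ~~ def w by rewrite /sur /def; lia.
  case/splitPr: {us uniqs sL pos} ws us0 min_len => p1 p2.
  rewrite rcons_cat cat_path size_cat /= size_rcons => /and3P[up1 p1w wp2] min_len.
  split; apply/negP => xw.
    by have := min_len _ _ _ xw dv wp2 (last_rcons _ _ _); rewrite size_rcons; lia.
  have := min_len u w (rcons p1 w) su xw; rewrite rcons_path up1 p1w last_rcons.
  by move=> /(_ isT erefl); rewrite size_rcons; lia.
have [su0 uns vns uv] : [/\ uniq s, u \notin s, v \notin s & u != v].
  move: uniqs; rewrite /= mem_rcons inE negb_or rcons_uniq.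
  by move=> /andP[/andP[-> ->] /andP[-> ->]].
exists u, v, s, (fun w => 0 < m (lshift n w))%N; split=> //.
- split=> // s' us' sv' sub.
  case/shortenP: us' sv' sub => s'' us'' uniqs'' sub'' sv'' sub.
  have {}sub'' : {subset u :: s'' <= u :: s'}.
    by move=> k; rewrite !inE => /predU1P[->|/sub''->]; rewrite ?eqxx ?orbT.
  have live'' : path (live m) u s''.
    by apply: path_live us'' _ => k /sub''/sub/pos.
  have [] // := @uniq_min_size _ (u :: s'') (u :: rcons s v) uniqs''.
  - by move=> k /sub''/sub.
  - exact: min_len su dv live'' sv''.
  by move=> _ Es k; rewrite -Es => /sub''.
- have vDp w : w \in s -> (0 < m (lshift n w) + m (rshift n w))%N.
    by move=> ws; apply: pos; rewrite inE mem_rcons inE ws !orbT.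
  move: su dv; rewrite /sur /def => su dv; have := vD u; have := vD v => vDv vDu.
  split; apply/mnm_lepP => t; rewrite -(splitK t); case: (split t) => k /=.
  + rewrite path_monL //; case: eqVneq => [<-|_]; first by rewrite (negPf uns); lia.
    by case: (k \in s) => //=; lia.
  + rewrite path_monR //; case: eqVneq => [<-|_]; first by rewrite (negPf vns); lia.
    by case: (boolP (k \in s)) => //= ks; have := vDp k ks; lia.
  + rewrite path_monL //; case: eqVneq => [<-|_]; first by rewrite (negPf vns); lia.
    by case: (boolP (k \in s)) => //= ks; rewrite -bal //; lia.
  rewrite path_monR //; case: eqVneq => [<-|_]; first by rewrite (negPf uns); lia.
  case: (boolP (k \in s)) => //= ks; have := vDp k ks; have := vD k; have := bal k ks; lia.
Qed.

End Tokens.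

(** * Weight orders *)

Section WeightOrder.
Variables (N : nat) (w : 'I_N -> nat).
Implicit Types m : 'X_{1..N}.

Definition weight m : nat := (\sum_i w i * m i)%N.

Lemma weightD m m' : weight (m + m') = (weight m + weight m')%N.
Proof. by rewrite -big_split; apply: eq_bigr => i _; rewrite mnmDE mulnDr. Qed.

Lemma weight1 i : weight U_(i) = w i.
Proof.
rewrite /weight (bigD1 i) //= big1 ?addn0 ?mnm1E ?eqxx ?muln1 // => j ji.
by rewrite mnm1E eq_sym (negPf ji) muln0.
Qed.

(** A weight vector is only a preorder; ties are broken by the degree-lexicographic
    order. *)
Definition weight_le : rel 'X_{1..N} := fun m m' =>
  (weight m < weight m')%N || (weight m == weight m') && (m <= m')%O.

Lemma weight_monomial_order : monomial_order weight_le.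
Proof.
split=> [m m'|m m'|m2 m1 m3|m|p m m']; rewrite /weight_le.
- by have := le_total m m'; case: ltngtP.
- by case: ltngtP => //= _ /le_anti.
- case: (ltngtP (weight m1) (weight m2)) => //=; last first.
    move=> -> le12; case: ltngtP => //= _; exact: le_trans.
  move=> lt12 _ /orP[lt23|/andP[/eqP<- _]]; last by rewrite lt12.
  by rewrite (ltn_trans lt12).
- have -> : weight 0%MM = 0%N by rewrite /weight big1 // => i _; rewrite mnm0E muln0.
  by case: posnP => //= ->; rewrite eqxx mpoly.le0m.
by rewrite !weightD ltn_add2r eqn_add2r lemc_add2l.
Qed.

End WeightOrder.

(** * The binomial edge ideal *)

Section BinomialEdgeIdeal.
Variables (n : nat) (F : fieldType) (e : rel 'I_n).
Hypothesis e_sym : ssrbool.symmetric e.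
Local Notation I := (binomial_edge_ideal F e).
Implicit Types (m p q : 'X_{1..n + n}) (i j k u v w : 'I_n) (s : seq 'I_n).

(** The token on the first interior vertex w relays the exchange: with t = x_w, one
    exchanges w with v and then u with w; with t = y_w, the other way round. *)
Lemma path_binomial_mem u s (t : 'I_n -> {mpoly F[n + n]}) :
  (forall k, t k = xvar F k \/ t k = yvar F k) -> path e u s ->
  I ((\prod_(k <- interior u s) t k) * edge_binomial F u (last u s)).
Proof.
move=> tP; elim: s u => [|w s IHs] u /=.
  by move=> _; rewrite /edge_binomial subrr mulr0; apply: ideal_span0.
move=> /andP[uw ws]; have Iuw : I (edge_binomial F u w).
  by apply: mem_ideal_span; exists u, w.
case: s => [|w' s] in IHs ws *; first by rewrite big_nil mul1r.
have {IHs ws} := IHs w ws; rewrite /interior /= big_cons.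
set P := \prod_(_ <- _) _; set v := last _ _ => Iwv.
case: (tP w) => ->.
  have -> : xvar F w * P * edge_binomial F u v =
      xvar F u * (P * edge_binomial F w v) + (P * xvar F v) * edge_binomial F u w.
    by rewrite /edge_binomial; ring.
  by apply: ideal_spanD; apply: ideal_spanM.
have -> : yvar F w * P * edge_binomial F u v =
    yvar F u * (P * edge_binomial F w v) + (P * yvar F v) * edge_binomial F u w.
  by rewrite /edge_binomial; ring.
by apply: ideal_spanD; apply: ideal_spanM.
Qed.

Lemma interior_rcons u s v : interior u (rcons s v) = s.
Proof. by rewrite /interior belast_rcons. Qed.

Definition color_var (c : pred 'I_n) k : {mpoly F[n + n]} :=
  if c k then xvar F k else yvar F k.

Lemma path_mon_binomial u v s c :
  'X_[path_mon u v s c] - 'X_[path_mon v u s c] =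
  (\prod_(k <- s) color_var c k) * edge_binomial F u v.
Proof.
have colE : \prod_(k <- s) color_var c k =
    'X_[\sum_(k <- s) U_(if c k then lshift n k else rshift n k)].
  elim: s => [|k s IHs]; first by rewrite !big_nil mpolyX0.
  by rewrite !big_cons mpolyXD IHs /color_var; case: (c k).
by rewrite !mpolyXD -mulrBr colE /edge_binomial.
Qed.

Lemma path_mon_mem u v s c :
  path e u (rcons s v) -> I ('X_[path_mon u v s c] - 'X_[path_mon v u s c]).
Proof.
move=> us; rewrite path_mon_binomial; have := @path_binomial_mem u _ (color_var c) _ us.
rewrite interior_rcons last_rcons; apply => k.
by rewrite /color_var; case: (c k); [left | right].
Qed.

Lemma path_mon_neq u v s c : chordless e u v s -> path_mon u v s c != path_mon v u s c.
Proof.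
move=> [_ + _]; rewrite /= mem_rcons inE negb_or rcons_uniq.
move=> /andP[/andP[uv us] /andP[vs s_uniq]].
apply/eqP => /mnmP/(_ (lshift n u)); rewrite !path_monL // (negPf us).
by rewrite eqxx eq_sym (negPf uv).
Qed.

Lemma edge_generator_key f :
  (exists i j, e i j /\ f = edge_binomial F i j) ->
  exists m m',
    (forall q, component_key e (q + m) = component_key e (q + m')) /\
    f = 'X_[m] - 'X_[m'].
Proof.
move=> [i [j [eij ->]]].
exists (U_(lshift n i) + U_(rshift n j))%MM, (U_(lshift n j) + U_(rshift n i))%MM.
by rewrite !mpolyXD; split=> // q; apply: edge_swap_key.
Qed.

(** By induction on the total surplus of x-tokens of m over m', which the exchange
    given by key_split decreases by one. *)
Lemma key_binomial m m' : component_key e m = component_key e m' -> I ('X_[m] - 'X_[m']).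
Proof.
pose dist m := (\sum_k (m (lshift n k) - m' (lshift n k)))%N.
have [d] := ubnP (dist m); elim: d m => // d IHd m; rewrite ltnS => md km.
have [->|/eqP ne] := eqVneq m m'; first by rewrite subrr; apply: ideal_span0.
have [u [v [s [c [chs [pm pm'] su dv]]]]] := key_split e_sym km ne.
have [us _ _] := chs.
set m1 := (m - path_mon u v s c + path_mon v u s c)%MM.
have Imm1 : I ('X_[m] - 'X_[m1]).
  by rewrite -{1}(submK pm); apply/ideal_span_shift/path_mon_mem.
have km1 : component_key e m1 = component_key e m'.
  rewrite -km; apply/esym.
  apply: (binomial_key (@key_mdeg _ e) edge_generator_key Imm1).
have -> : 'X_[m] - 'X_[m'] = ('X_[m] - 'X_[m1]) + ('X_[m1] - 'X_[m']) :> {mpoly F[n+n]}.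
  by ring.
apply: ideal_spanD => //; apply: IHd km1; apply: leq_trans md.
move: chs => [_ + _]; rewrite /= mem_rcons inE negb_or rcons_uniq.
move=> /andP[/andP[uv uns] /andP[vns s_uniq]].
have m1E k : (m1 (lshift n k) + (u == k) = m (lshift n k) + (v == k))%N.
  have -> : m1 (lshift n k) =
      (m (lshift n k) - path_mon u v s c (lshift n k) + path_mon v u s c (lshift n k))%N.
    by rewrite mnmDE mnmBE.
  have /mnm_lepP/(_ (lshift n k)) := pm.
  by rewrite !path_monL //; move: (_ && _ : nat) (u == k : nat) (v == k : nat); clear; lia.
rewrite /dist (bigD1 u) //= [ltnRHS](bigD1 u) //= -addSn; apply: leq_add.
  by have := m1E u; rewrite eqxx eq_sym (negPf uv); lia.
apply: leq_sum => k ku; have := m1E k; rewrite eq_sym (negPf ku).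
by move: dv; case: eqVneq => [<-|_]; clear; lia.
Qed.

Lemma mem_binomial_key m m' : I ('X_[m] - 'X_[m']) <-> component_key e m = component_key e m'.
Proof.
split; last exact: key_binomial.
exact: (binomial_key (@key_mdeg _ e) edge_generator_key).
Qed.

(** Let p and p' divide the two monomials of the path binomial, distinct and in the
    same class.  By key_split some weakly admissible path binomial divides
    (p, p').  On an interior vertex of the given path p and p' carry the same
    token, so the path so found goes from u to v; it runs inside the given
    one, hence covers it, so p has full support and is the whole monomial. *)
Lemma path_primitive u v s c :
  chordless e u v s -> primitive_in I (path_mon u v s c) (path_mon v u s c).
Proof.
move=> chs; have [us uniqs smin] := chs; have nem := path_mon_neq c chs.
split; first by split; last exact: path_mon_mem.
move=> p p' [/eqP nep /mem_binomial_key kp] pm pm'.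
move: (uniqs); rewrite /= mem_rcons inE negb_or rcons_uniq.
move=> /andP[/andP[uv uns] /andP[vns s_uniq]].
have vE := key_vertex_deg kp.
have pL k := mnm_lepP pm (lshift n k); have pR k := mnm_lepP pm (rshift n k).
have p'L k := mnm_lepP pm' (lshift n k); have p'R k := mnm_lepP pm' (rshift n k).
have vD k : (p (lshift n k) + p (rshift n k) = p' (lshift n k) + p' (rshift n k))%N.
  exact: vE.
have [a [b [s' [c' [chs' [qp qp'] sa db]]]]] := key_split e_sym kp nep.
have [as' uniqs' _] := chs'.
have au : a = u.
  apply/esym/eqP; move: (pL a) (pR a) (p'L a) (p'R a) (vD a) sa.
  rewrite !path_monL // !path_monR //.
  by case: (u == a) => //; case: (v == a); case: (a \in s); case: (c a) => /=; clear; lia.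
have bv : b = v.
  apply/esym/eqP; move: (pL b) (pR b) (p'L b) (p'R b) (vD b) db.
  rewrite !path_monL // !path_monR //.
  by case: (v == b) => //; case: (u == b); case: (b \in s); case: (c b) => /=; clear; lia.
rewrite {a}au {b}bv in sa db chs' qp qp' as' uniqs'.
have s'_uniq : uniq s' by move: uniqs'; rewrite /= rcons_uniq => /and3P[].
have pos k : k \in u :: rcons s' v -> (0 < vertex_deg p k)%N.
  have := mnm_lepP qp (lshift n k); have := mnm_lepP qp (rshift n k).
  rewrite path_monL // path_monR // /vertex_deg inE mem_rcons inE [k == u]eq_sym [k == v]eq_sym.
  by case: (u == k); case: (v == k); case: (k \in s'); case: (c' k) => /=; clear; lia.
have sub : {subset u :: rcons s v <= u :: rcons s' v}.
  apply: smin => //; first by rewrite last_rcons.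
  move=> k /pos; rewrite /vertex_deg; move: (pL k) (pR k).
  rewrite path_monL // path_monR // inE mem_rcons inE [k == u]eq_sym [k == v]eq_sym.
  by case: (u == k); case: (v == k); case: (k \in s); case: (c k) => /=; clear; lia.
have full k : (vertex_deg (path_mon u v s c) k <= vertex_deg p k)%N.
  rewrite {1}/vertex_deg path_monL // path_monR //.
  have := pos k; have := sub k; rewrite !inE !mem_rcons !inE.
  rewrite [k == u]eq_sym [k == v]eq_sym.
  case: eqVneq => [<-|_] /=.
    by rewrite (negPf uns) eq_sym (negPf uv) => _ /(_ isT).
  case: eqVneq => [<-|_] /=; first by rewrite (negPf vns) => _ /(_ isT).
  by case: (k \in s) => //= /(_ isT) h /(_ h); case: (c k).
have pE : p = path_mon u v s c.
  apply/mnmP => t; rewrite -(splitK t); case: (split t) => k /=;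
    have := full k; rewrite /vertex_deg; have := pL k; have := pR k; clear; lia.
congr pair => //; apply: lepm_mdeg_eq pm' _.
rewrite -(key_mdeg kp) pE; apply: (@key_mdeg _ e).
by apply/mem_binomial_key; apply: path_mon_mem.
Qed.

Lemma primitive_path m m' : primitive_in I m m' ->
  exists u v s c, [/\ chordless e u v s, m = path_mon u v s c & m' = path_mon v u s c].
Proof.
move=> [[/eqP ne /mem_binomial_key km] mmin].
have [u [v [s [c [chs [pm pm'] _ _]]]]] := key_split e_sym km ne.
have [us _ _] := chs; exists u, v, s, c.
suff [-> ->] : (path_mon u v s c, path_mon v u s c) = (m, m') by split.
by apply: mmin => //; split; [apply: path_mon_neq | apply: path_mon_mem].
Qed.

Lemma graver_path f : graver_basis I f <->
  exists u v s c, chordless e u v s /\ f = 'X_[path_mon u v s c] - 'X_[path_mon v u s c].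
Proof.
split=> [[m [m' [/primitive_path[u [v [s [c [chs -> ->]]]]] ->]]]|].
  by exists u, v, s, c.
move=> [u [v [s [c [chs ->]]]]]; exists (path_mon u v s c), (path_mon v u s c).
by split=> //; apply: path_primitive.
Qed.

Lemma weakly_admissible_path f : weakly_admissible_binomials F e f <->
  exists u v s c, chordless e u v s /\ f = 'X_[path_mon u v s c] - 'X_[path_mon v u s c].
Proof.
split.
  move=> [[i [j [s [wa [t [tP ->]]]]]]] nz.
  case/lastP: s => [|s v] in wa nz *.
    by case: wa nz => -[_ /= <-] _ _; rewrite /edge_binomial subrr mulr0.
  have vj : v = j by case: wa => -[_]; rewrite last_rcons.
  rewrite vj in wa nz *; rewrite interior_rcons.
  exists i, j, s, (fun k => t k == xvar F k); split; first exact/chordlessP.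
  rewrite path_mon_binomial; congr (_ * _); apply: eq_bigr => k _.
  by rewrite /color_var; case: eqP (tP k) => [->//|ne []//].
move=> [u [v [s [c [chs ->]]]]]; split; last first.
  apply/eqP; rewrite -msupp_eq0; apply/eqP => E.
  have := msupp_binomial F (path_mon_neq c chs) (path_mon u v s c).
  by rewrite E mem_head.
exists u, v, (rcons s v); split; first exact/chordlessP.
exists (color_var c); rewrite interior_rcons path_mon_binomial; split=> // k.
by rewrite /color_var; case: (c k); [left | right].
Qed.

Lemma path_mon_mdeg u v s c : chordless e u v s -> (mdeg (path_mon u v s c) <= n + n)%N.
Proof.
move=> [_ + _]; rewrite /= mem_rcons inE negb_or rcons_uniq.
move=> /andP[/andP[uv uns] /andP[vns s_uniq]].
rewrite mdegE -[leqRHS]card_ord -sum1_card; apply: leq_sum => t _.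
rewrite -(splitK t); case: (split t) => k /=; rewrite ?path_monL ?path_monR //;
  case: eqVneq => [<-|_]; rewrite ?(negPf uns) ?(negPf vns) ?addn0 //;
  by case: (_ && _).
Qed.

(** Weights of the x-variables: 0 on the interior vertices coloured x, then 1 on v,
    2 on u, and 3 on the others.  Exchanging x_a y_b for x_b y_a lowers the
    weight when the weight of b is below that of a.  The x-tokens of the trailing
    monomial of the path sit on the cheapest vertices of the path, those of
    the leading monomial too but for u taking the place of v. *)
Definition path_weight u v s (c : pred 'I_n) (t : 'I_(n + n)) : nat :=
  match fintype.split t with
  | inl k => if k == u then 2 else if k == v then 1
             else if (k \in s) && c k then 0 else 3
  | inr _ => 0
  end.

(** In a primitive binomial whose leading monomial divides that of the path, the
    exchange takes an x-token from weight 0 or 2 and a y-token from weight 1 or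
    3, and is profitable only from u to v.  Below the trailing monomial, the
    x-tokens have weight at most 1 and the y-tokens at least 2, so that no
    exchange is profitable. *)
Lemma path_universal u v s c : chordless e u v s ->
  universal_groebner_basis I ('X_[path_mon u v s c] - 'X_[path_mon v u s c]).
Proof.
move=> chs; have [us uniqs _] := chs.
move: (uniqs); rewrite /= mem_rcons inE negb_or rcons_uniq.
move=> /andP[/andP[uv uns] /andP[vns s_uniq]].
pose W := path_weight u v s c.
have WL k : W (lshift n k) =
    (if k == u then 2 else if k == v then 1
     else if (k \in s) && c k then 0 else 3)%N.
  by rewrite /W /path_weight -[lshift n k]/(unsplit (inl k)) unsplitK.
have WR k : W (rshift n k) = 0%N.
  by rewrite /W /path_weight -[rshift n k]/(unsplit (inr k)) unsplitK.
have WM a b s' c' : (weight W (path_mon a b s' c') + W (lshift n b) =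
    weight W (path_mon b a s' c') + W (lshift n a))%N.
  by rewrite !weightD !weight1 !WR; lia.
have le_path_mon a b s' c' :
    (W (lshift n a) < W (lshift n b))%N -> ~~ weight_le W (path_mon b a s' c') (path_mon a b s' c').
  by have := WM a b s' c'; rewrite /weight_le; case: ltngtP => //=; lia.
have prim := path_primitive c chs.
have Wx k : (0 < path_mon u v s c (lshift n k))%N ->
    W (lshift n k) = if k == u then 2%N else 0%N.
  rewrite WL path_monL // [u == k]eq_sym; case: eqVneq => // _.
  by case: eqVneq => [->|_]; [rewrite (negPf vns) | case: (_ && _)].
have Wy k : (0 < path_mon u v s c (rshift n k))%N ->
    W (lshift n k) = if k == v then 1%N else 3%N.
  rewrite WL path_monR //; have [->|_] := eqVneq k u.
    by rewrite (negPf uns) eq_sym (negPf uv).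
  by rewrite [v == k]eq_sym; case: eqVneq => // _; case: (k \in s); case: (c k).
have W'x k : (0 < path_mon v u s c (lshift n k))%N -> (W (lshift n k) <= 1)%N.
  rewrite WL path_monL //; have [->|_] := eqVneq k u.
    by rewrite (negPf uns) eq_sym (negPf uv).
  by rewrite [v == k]eq_sym; case: eqVneq => // _; case: (_ && _).
have W'y k : (0 < path_mon v u s c (rshift n k))%N -> (1 < W (lshift n k))%N.
  rewrite WL path_monR // [u == k]eq_sym; case: eqVneq => // _.
  case: eqVneq => [->|_]; first by rewrite (negPf vns).
  by case: (k \in s); case: (c k).
have path_mon_ends a b s' c' m : uniq s' -> (path_mon a b s' c' <= m)%MM ->
    (0 < m (lshift n a))%N /\ (0 < m (rshift n b))%N.
  move=> us' /mnm_lepP le_m; split; apply: leq_trans (le_m _).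
    by rewrite path_monL // eqxx addn1.
  by rewrite path_monR // eqxx addn1.
have chs_uniq a b s' : chordless e a b s' -> uniq s'.
  by case=> _ + _; rewrite /= rcons_uniq => /and3P[].
apply: (@primitive_universal _ F _ (component_key e) _ (@key_mdeg _ e) edge_generator_key
  key_binomial _ (weight_monomial_order W) (n + n).+1 _ _ _ prim).
- move=> p p' /primitive_path[a [b [s' [c' [chs' -> _]]]]].
  by rewrite ltnS; apply: path_mon_mdeg chs'.
- move=> p p' Pp pm lep; have [a [b [s' [c' [chs' Ep Ep']]]]] := primitive_path Pp.
  have us' := chs_uniq _ _ _ chs'; have pm_ab := pm; rewrite Ep in pm_ab.
  have [/Wx Wa /Wy Wb] := path_mon_ends _ _ _ _ _ us' pm_ab.
  have [au bv] : a = u /\ b = v.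
    have : ~~ (W (lshift n a) < W (lshift n b))%N.
      by apply: contraL lep => /le_path_mon; rewrite Ep Ep'; apply.
    by rewrite Wa Wb; case: eqVneq => [->|_]; case: eqVneq => [->|_].
  have pm' : (p' <= path_mon v u s c)%MM.
    rewrite Ep' au bv; apply/mnm_lepP => t; rewrite -(splitK t).
    have := mnm_lepP pm_ab t; rewrite -{1 2}(splitK t) au bv.
    by case: (fintype.split t) => k /=; rewrite ?path_monL ?path_monR // !leq_add2r.
  by have /(congr1 (@fst _ _)) := prim.2 p p' Pp.1 pm pm'.
move=> p p' Pp pm; have [a [b [s' [c' [chs' Ep Ep']]]]] := primitive_path Pp.
rewrite Ep in pm; have us' := chs_uniq _ _ _ chs'.
have [/W'x Wa /W'y Wb] := path_mon_ends _ _ _ _ _ us' pm.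
by rewrite Ep Ep'; apply/le_path_mon/(leq_ltn_trans Wa Wb).
Qed.

End BinomialEdgeIdeal.

Theorem theorem2p6 (n : nat) (hn : (0 < n)%N) (F : fieldType) (e : rel 'I_n)
    (e_sym : ssrbool.symmetric e) (e_irr : irreflexive e)
    (e_conn : forall i j : 'I_n, connect e i j) :
  weakly_admissible_binomials F e
    = universal_groebner_basis (binomial_edge_ideal F e) /\
  universal_groebner_basis (binomial_edge_ideal F e)
    = graver_basis (binomial_edge_ideal F e).
Proof.
have S_Gr f : weakly_admissible_binomials F e f <->
    graver_basis (binomial_edge_ideal F e) f.
  exact: iff_trans (weakly_admissible_path _ _) (iff_sym (graver_path e_sym _)).
have U_Gr : universal_groebner_basis (binomial_edge_ideal F e)
    = graver_basis (binomial_edge_ideal F e).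
  apply/seteqP; split=> f.
    move=> [le [G [le_mon redG Gf]]].
    exact: (reduced_primitive (@key_mdeg _ e) (edge_generator_key e_sym)
      (key_binomial F e_sym) le_mon redG Gf).
  by move=> /(graver_path e_sym)[u [v [s [c [chs ->]]]]]; apply: path_universal.
by split=> //; rewrite U_Gr; apply/seteqP; split=> f /S_Gr.
Qed.
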